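(* Let $g:\mathbb{R}\to\mathbb{R}$ be a locally Lipschitz function. For every differentiability point $u$ of $g$, let $$\varphi_u(x)=\min\Big\{g(u+t)-g(u)-g'(u)t:\ |t|\le x\Big\},\qquad x\ge0.$$ If there are an $\varepsilon>0$ and a dense subset $D\subset\mathbb{R}$ consisting of differentiability points of $g$ such that the function $$u\in D\;\mapsto\;\int_0^\varepsilon\frac{\varphi_u(x)}{x^2}\,dx$$ is bounded on every bounded subset of $D$, then there is a separately convex function $f:\mathbb{R}^2\to\mathbb{R}$ such that $f(u,u)=g(u)$ for each $u\in\mathbb{R}$.
   Context: A function $f:\mathbb{R}^2\to\mathbb{R}$ is called separately convex if it is convex on every line parallel to a coordinate axis. *)

(* Defs.v *)
From HB Require Import structures.
From mathcomp Require Import all_boot all_order all_algebra.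
From mathcomp Require Import all_classical all_reals all_analysis.
Set Implicit Arguments. Unset Strict Implicit. Unset Printing Implicit Defensive.
Import Order.TTheory GRing.Theory Num.Theory.
Import numFieldNormedType.Exports.
Local Open Scope classical_set_scope.
Local Open Scope ring_scope.

Definition locally_lipschitz (R : realType) (g : R -> R) : Prop :=
  forall x : R, exists r : R, exists L : R, 0 < r /\
    forall y z : R, `|y - x| < r -> `|z - x| < r -> `|g y - g z| <= L * `|y - z|.

Definition convex_fun (R : realType) (h : R -> R) : Prop :=
  forall a b t : R, 0 <= t -> t <= 1 ->
    h (t * a + (1 - t) * b) <= t * h a + (1 - t) * h b.

Definition separately_convex (R : realType) (f : R -> R -> R) : Prop :=
  (forall y : R, convex_fun (fun x => f x y)) /\
  (forall x : R, convex_fun (fun y => f x y)).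

(* phi_u(x) = min { g(u+t) - g(u) - g'(u) t : |t| <= x }  (written as an
   infimum; for continuous g and x >= 0 this infimum is attained) *)
Definition phi (R : realType) (g : R -> R) (u x : R) : R :=
  inf [set g (u + t) - g u - derive1 g u * t | t in [set t : R | `|t| <= x]].

Definition phi_integral (R : realType) (g : R -> R) (eps u : R) : \bar R :=
  let I : set R := `]0, eps]%classic in
  (\int[lebesgue_measure]_(x in I) ((phi g u x) / x ^+ 2)%:E)%E.

(* Main.v *)
(* Let b(x, y) be - xy on the square [-1, 1]^2 and |x - y| - 1 outside of it.  The two
   formulas agree on the boundary of the square, b is separately convex, b(0, 0) = 0,
   b(t, t) = - min(t^2, 1), and |b(x, y)| <= |x| + |y|.  With e = eps / 2 and
   a_k = - phi_u(e / 2^k), the integral condition bounds sum_k a_k 2^k, so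
     h_u(x, y) = sum_k a_k b(2^(k+1) x / e, 2^(k+1) y / e)
   converges to a separately convex function of linear growth with h_u(0, 0) = 0 and
   h_u(t, t) <= phi_u(|t|) for |t| <= e.

   If g >= 0, then for large K_u the separately convex functions
     g(u) + g'(u) ((x - u) + (y - u)) / 2 + h_u(x - u, y - u) - K_u (x - u) (y - u)
   have traces below g, touch g at u, and are locally bounded above uniformly in u;
   their supremum over u in D has trace g, by density of D.

   In general, choose a convex G >= - g such that - G is the trace of a separately
   convex P.  Adding G to g only increases the functions phi_u, so g + G >= 0 is the
   trace of some separately convex f, and f + P has trace g. *)
Require Import Defs.
From HB Require Import structures.
From mathcomp Require Import all_boot all_order all_algebra.
From mathcomp Require Import all_classical all_reals all_analysis.
From mathcomp Require Import measurable_realfun ring lra.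
Import Order.TTheory GRing.Theory Num.Theory.
Import numFieldNormedType.Exports.
Local Open Scope classical_set_scope.
Local Open Scope ring_scope.

(** * Closure properties of separate convexity: sums, products, affine substitutions, limits,
    suprema *)

Section SeparateConvexity.
Context {R : realType}.
Implicit Types (f h : R -> R -> R).

Lemma separately_convex_sym f :
  (forall x y, f x y = f y x) -> (forall y, convex_fun (fun x => f x y)) ->
  separately_convex f.
Proof.
move=> fC fcvx; split=> // x a b t t0 t1.
by rewrite fC (fC x a) (fC x b); exact: fcvx.
Qed.

Lemma separately_convexD f h : separately_convex f -> separately_convex h ->
  separately_convex (fun x y => f x y + h x y).
Proof.
move=> [f1 f2] [h1 h2]; split=> z a b t t0 t1.
- by have := f1 z a b t t0 t1; have := h1 z a b t t0 t1; lra.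
- by have := f2 z a b t t0 t1; have := h2 z a b t t0 t1; lra.
Qed.

Lemma separately_convexZ (c : R) f : 0 <= c -> separately_convex f ->
  separately_convex (fun x y => c * f x y).
Proof.
move=> c0 [f1 f2]; split=> z a b t t0 t1.
- by have := ler_wpM2l c0 (f1 z a b t t0 t1); lra.
- by have := ler_wpM2l c0 (f2 z a b t t0 t1); lra.
Qed.

Lemma separately_convex_bilinear (c0 c1 c2 c3 : R) :
  separately_convex (fun x y => c0 + c1 * x + c2 * y + c3 * (x * y)).
Proof.
by split=> z a b t _ _ /=; rewrite le_eqVlt; apply/orP; left; apply/eqP; ring.
Qed.

Lemma separately_convex_affine (c d : R) f : separately_convex f ->
  separately_convex (fun x y => f (c * x + d) (c * y + d)).
Proof.
move=> [f1 f2]; split=> z a b t t0 t1.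
- have -> : c * (t * a + (1 - t) * b) + d =
            t * (c * a + d) + (1 - t) * (c * b + d) by ring.
  exact: f1.
- have -> : c * (t * a + (1 - t) * b) + d =
            t * (c * a + d) + (1 - t) * (c * b + d) by ring.
  exact: f2.
Qed.

Lemma separately_convexM (a b : R -> R) :
  (forall x, 0 <= a x) -> (forall x, 0 <= b x) ->
  convex_fun a -> convex_fun b -> separately_convex (fun x y => a x * b y).
Proof.
move=> a0 b0 ca cb; split=> z x y t t0 t1.
- by have := ler_wpM2r (b0 z) (ca x y t t0 t1); lra.
- by have := ler_wpM2l (a0 z) (cb x y t t0 t1); lra.
Qed.

Lemma separately_convex_sum n (F : nat -> R -> R -> R) :
  (forall k, separately_convex (F k)) ->
  separately_convex (fun x y => \sum_(k < n) F k x y).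
Proof.
move=> Fcvx; elim: n => [|n [IH1 IH2]].
  by split=> z a b t _ _; rewrite !big_ord0; lra.
have [F1 F2] := Fcvx n; split=> z a b t t0 t1; rewrite !big_ord_recr /=.
- by have := IH1 z a b t t0 t1; have := F1 z a b t t0 t1; lra.
- by have := IH2 z a b t t0 t1; have := F2 z a b t t0 t1; lra.
Qed.

Lemma separately_convex_cvg (F : nat -> R -> R -> R) f :
  (forall n, separately_convex (F n)) ->
  (forall x y, (fun n => F n x y) @ \oo --> f x y) -> separately_convex f.
Proof.
move=> Fcvx Ff; split=> z a b t t0 t1.
- apply: (ler_cvg_to (Ff _ _) (cvgD (cvgM (cvg_cst t) (Ff _ _))
     (cvgM (cvg_cst (1 - t)) (Ff _ _)))).
  by near=> n; exact: (Fcvx n).1.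
- apply: (ler_cvg_to (Ff _ _) (cvgD (cvgM (cvg_cst t) (Ff _ _))
     (cvgM (cvg_cst (1 - t)) (Ff _ _)))).
  by near=> n; exact: (Fcvx n).2.
Unshelve. all: by end_near.
Qed.

Lemma separately_convex_sup (I : Type) (D : set I) (F : I -> R -> R -> R) :
  D !=set0 -> (forall i, D i -> separately_convex (F i)) ->
  (forall x y, has_ubound [set F i x y | i in D]) ->
  separately_convex (fun x y => sup [set F i x y | i in D]).
Proof.
move=> D0 Fcvx Fub.
have Fle x y i : D i -> F i x y <= sup [set F i x y | i in D].
  by move=> Di; apply: ub_le_sup => //; exists i.
have F0 x y : [set F i x y | i in D] !=set0.
  by case: D0 => i Di; exists (F i x y), i.
split=> z a b t t0 t1; apply: ge_sup => // _ [i Di <-].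
- apply: le_trans ((Fcvx i Di).1 z a b t t0 t1) _.
  by apply: lerD; rewrite ler_wpM2l ?subr_ge0//; exact: Fle.
- apply: le_trans ((Fcvx i Di).2 z a b t t0 t1) _.
  by apply: lerD; rewrite ler_wpM2l ?subr_ge0//; exact: Fle.
Qed.

End SeparateConvexity.

(** * The truncated saddle: convexity, diagonal values and linear growth *)

Section Saddle.
Context {R : realType}.

Definition saddle (x y : R) : R :=
  if (`|x| <= 1) && (`|y| <= 1) then - (x * y) else `|x - y| - 1.

Lemma saddleC x y : saddle x y = saddle y x.
Proof. by rewrite /saddle andbC mulrC distrC. Qed.

(** On the square the gap factors as [(1 - x) * (1 + y)] when [x >= y] and as [(1 + x) * (1 - y)]
    otherwise, with nonnegative factors. *)
Lemma saddle_ge_dist x y : `|x - y| - 1 <= saddle x y.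
Proof.
rewrite /saddle; case: ifPn => // /andP[]; rewrite !ler_norml.
move=> /andP[? ?] /andP[? ?].
by have [?|?] := ler0P (x - y); nra.
Qed.

(** Outside the square the gap is [(x - 1) * (1 + y)] for [x > 1] and [(x + 1) * (y - 1)] for
    [x < -1], nonnegative in both cases. *)
Lemma saddle_ge_bilinear x y : `|y| <= 1 -> - (x * y) <= saddle x y.
Proof.
move=> y1; rewrite /saddle y1 andbT; case: ifPn => //.
move: y1; rewrite -ltNge ler_norml lter_normr => /andP[? ?] /orP[?|?];
by have [?|?] := ler0P (x - y); nra.
Qed.

(** Whichever formula holds at the intermediate point is convex in the first variable and lies below
    [saddle] at both end points by the two bounds above, so Jensen's inequality for that formula
    suffices. *)
Lemma saddle_separately_convex : separately_convex saddle.
Proof.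
apply: separately_convex_sym => [x y|y a b t t0 t1]; first exact: saddleC.
set z := t * a + (1 - t) * b.
rewrite {1}/saddle; case: ifPn => [/andP[_ y1]|_].
  have := saddle_ge_bilinear a y y1; have := saddle_ge_bilinear b y y1.
  by rewrite /z; nra.
apply: (@le_trans _ _ (t * (`|a - y| - 1) + (1 - t) * (`|b - y| - 1))); last first.
  by apply: lerD; apply: ler_wpM2l; rewrite ?subr_ge0// saddle_ge_dist.
have -> : z - y = t * (a - y) + (1 - t) * (b - y) by rewrite /z; ring.
have := ler_normD (t * (a - y)) ((1 - t) * (b - y)).
have t1' : 0 <= 1 - t by lra.
by rewrite !normrM (ger0_norm t0) (ger0_norm t1'); lra.
Qed.

Lemma saddle_diag_le0 t : saddle t t <= 0.
Proof. by rewrite /saddle subrr normr0; case: ifP => _; nra. Qed.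

Lemma saddle_diag_leN1 t : 1 <= `|t| -> saddle t t <= -1.
Proof.
move=> t1; rewrite /saddle subrr normr0; case: ifP => _; last by lra.
by rewrite -expr2 -(real_normK (num_real t)) expr2; nra.
Qed.

Lemma saddle_le x y : `|saddle x y| <= `|x| + `|y|.
Proof.
rewrite /saddle; case: ifPn => [/andP[x1 y1]|].
  by rewrite normrN normrM; have := normr_ge0 x; have := normr_ge0 y; nra.
rewrite negb_and -!ltNge => xy1.
have := ler_normB x y; have := normr_ge0 (x - y).
have := normr_ge0 x; have := normr_ge0 y.
move: xy1 => /orP[?|?] ? ? ? ?; rewrite ler_norml; apply/andP; split; lra.
Qed.

End Saddle.

(** * Dyadic superposition of rescaled saddles *)

Section SaddleSeries.
Context {R : realType}.
Variables (e C : R) (a : nat -> R).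
Hypotheses (e0 : 0 < e) (a0 : forall k, 0 <= a k).
Hypothesis aC : forall n, \sum_(k < n) a k * 2 ^+ k <= C.

(** The scale is chosen so that the diagonal value has dropped to [- a k] or below once [t] is at
    distance [e / 2 ^+ k.+1] from 0. The [+ 0] gives the shape expected by
    [separately_convex_affine]. *)
Let term k (x y : R) :=
  a k * saddle (2 ^+ k.+1 / e * x + 0) (2 ^+ k.+1 / e * y + 0).

Definition saddle_series (x y : R) : R := limn (fun n => \sum_(k < n) term k x y).

(** Linear growth of [saddle] turns the rescaling into a factor [2 ^+ k.+1 / e]; this is why the
    coefficients are summed against [2 ^+ k]. *)
Let term_le k x y : `|term k x y| <= 2 / e * (`|x| + `|y|) * (a k * 2 ^+ k).
Proof.
rewrite /term normrM (ger0_norm (a0 k)).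
apply: le_trans (ler_wpM2l (a0 k) (saddle_le _ _)) _.
have s0 : 0 <= 2 ^+ k.+1 / e by rewrite divr_ge0 ?exprn_ge0// ltW.
rewrite !addr0 [`|_ * x|]normrM [`|_ * y|]normrM (ger0_norm s0) -mulrDr exprS le_eqVlt; apply/orP; left.
by apply/eqP; field; rewrite gt_eqF.
Qed.

Let sum_term_le n x y : \sum_(k < n) `|term k x y| <= 2 / e * (`|x| + `|y|) * C.
Proof.
apply: (@le_trans _ _ (\sum_(k < n) 2 / e * (`|x| + `|y|) * (a k * 2 ^+ k))).
  by apply: ler_sum => k _; exact: term_le.
rewrite -mulr_sumr ler_wpM2l// mulr_ge0// ?addr_ge0// divr_ge0// ltW//.
Qed.

Lemma saddle_series_cvg x y :
  (fun n => \sum_(k < n) term k x y) @ \oo --> saddle_series x y.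
Proof.
have -> : (fun n => \sum_(k < n) term k x y) = series (fun k => term k x y).
  by apply/funext => n; rewrite /series /= big_mkord.
have -> : saddle_series x y = limn (series (fun k => term k x y)).
  congr (limn _); apply/funext => n; by rewrite /series /= big_mkord.
apply: normed_cvg.
have -> : [normed series (fun k => term k x y)] =
          (fun n => \sum_(k < n) `|term k x y|).
  by apply/funext => n; rewrite /= /series /= big_mkord.
apply: nondecreasing_is_cvgn.
  by apply/nondecreasing_seqP => n; rewrite big_ord_recr /= lerDl.
by exists (2 / e * (`|x| + `|y|) * C) => _ [n _ <-]; exact: sum_term_le.
Qed.

Lemma saddle_series_separately_convex : separately_convex saddle_series.
Proof.
apply: (@separately_convex_cvg _ (fun n x y => \sum_(k < n) term k x y)).
  move=> n; apply: separately_convex_sum => k; apply: separately_convexZ => //.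
  apply: (@separately_convex_affine _ _ _ saddle).
  exact: saddle_separately_convex.
exact: saddle_series_cvg.
Qed.

Lemma saddle_series_le x y : `|saddle_series x y| <= 2 / e * (`|x| + `|y|) * C.
Proof.
apply: (ler_cvg_to (cvg_norm (saddle_series_cvg x y)) (cvg_cst _)).
by near=> n; apply: le_trans (ler_norm_sum _ _ _) (sum_term_le n x y).
Unshelve. all: by end_near.
Qed.

Let term_diag_le0 k t : term k t t <= 0.
Proof. by rewrite /term mulr_ge0_le0// saddle_diag_le0. Qed.

Lemma saddle_series_diag_le0 t : saddle_series t t <= 0.
Proof.
apply: (ler_cvg_to (saddle_series_cvg t t) (cvg_cst _)).
by near=> n; apply: sumr_le0.
Unshelve. all: by end_near.
Qed.

(** Every term is nonpositive on the diagonal, so the series is at most its [k]-th term, whose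
    saddle is at most -1 at this distance. *)
Lemma saddle_series_diag_le k t : e / 2 ^+ k.+1 <= `|t| ->
  saddle_series t t <= - a k.
Proof.
move=> kt; apply: (ler_cvg_to (saddle_series_cvg t t) (cvg_cst _)).
near=> n.
have kn : (k < n)%N by near: n; exact: nbhs_infty_gt.
rewrite (bigD1 (Ordinal kn))//= -[leRHS]addr0; apply: lerD; last exact: sumr_le0.
rewrite /term -mulrN1 ler_wpM2l// saddle_diag_leN1// addr0 normrM.
rewrite gtr0_norm ?divr_gt0 ?exprn_gt0//.
rewrite (_ : _ * _ = `|t| * 2 ^+ k.+1 / e); last by ring.
by rewrite ler_pdivlMr// mul1r -ler_pdivrMr// exprn_gt0.
Unshelve. all: by end_near.
Qed.

End SaddleSeries.

(** * Nonnegative traces as suprema of bumps *)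

Section TraceOfNonneg.
Context {R : realType}.
Variables (g p C : R -> R) (a : R -> nat -> R) (D : set R) (e : R).
Hypotheses (e0 : 0 < e) (densD : dense D) (g0 : forall x, 0 <= g x).
Hypothesis a0 : forall u k, D u -> 0 <= a u k.
Hypothesis aC : forall u n, D u -> \sum_(k < n) a u k * 2 ^+ k <= C u.
Hypothesis gp : forall u k (t : R), D u -> `|t| <= e / 2 ^+ k ->
  g u + p u * t - a u k <= g (u + t).
Hypothesis g_bnd : forall M : R, exists B : R, forall u, `|u| <= M -> g u <= B.
Hypothesis C_bnd : forall M : R, exists B : R, forall u, D u -> `|u| <= M -> C u <= B.
Hypothesis g_lsc : forall v d : R, 0 < d -> exists2 r : R, 0 < r &
  forall u, `|u - v| < r -> g v - d <= g u.

Let C0 u : D u -> 0 <= C u.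
Proof. by move=> /(aC u 0); rewrite big_ord0. Qed.

(** Testing [gp] at the coarsest scale [k = 0] with [t = e] and [t = - e] bounds [p u * e] from both
    sides, since [g u] is nonnegative and [g] is bounded near [u]. *)
Let p_bnd (M : R) : exists B : R, forall u, D u -> `|u| <= M -> `|p u| <= B.
Proof.
have [Bg HBg] := g_bnd (M + e); have [BC HBC] := C_bnd M.
exists ((Bg + BC) / e) => u Du uM.
have a0C : a u 0%N <= BC.
  apply: le_trans (HBC u Du uM); have := aC u 1 Du.
  by rewrite big_ord_recl big_ord0 addr0 mulr1.
have ue : `|u + e| <= M + e.
  by apply: le_trans (ler_normD _ _) _; rewrite (gtr0_norm e0) lerD2r.
have ue' : `|u - e| <= M + e.
  by apply: le_trans (ler_normB _ _) _; rewrite (gtr0_norm e0) lerD2r.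
have e1 : `|e| <= e / 2 ^+ 0 by rewrite expr0 divr1 (gtr0_norm e0).
have e2 : `|- e| <= e / 2 ^+ 0 by rewrite normrN.
have := gp u 0 e Du e1; have := gp u 0 (- e) Du e2.
have := HBg _ ue; have := HBg _ ue'; have := g0 u => ? ? ? ? ?.
by rewrite ler_pdivlMr// -[X in _ * X](gtr0_norm e0) -normrM ler_norml; lra.
Qed.

(* The first two summands push the trace of the bump below [0 <= g] at distance
   at least [e] from [u]; the others make the bumps locally bounded above,
   uniformly in [u]. *)
Let K u : R := `|g u| / e ^+ 2 + `|p u| / e +
  (`|g u| + (`|p u| + 4 / e * C u) * (2 * `|u|)).

Let K0 u : D u -> 0 <= K u.
Proof.
move=> Du; rewrite /K.
have ? := C0 u Du.
by rewrite !(addr_ge0, mulr_ge0, invr_ge0, exprn_ge0)// ltW.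
Qed.

Let K_bnd (M : R) : exists B : R, forall u, D u -> `|u| <= M -> K u <= B.
Proof.
have [Bg HBg] := g_bnd M; have [BC HBC] := C_bnd M; have [Bp HBp] := p_bnd M.
exists (Bg / e ^+ 2 + Bp / e + (Bg + (Bp + 4 / e * BC) * (2 * M))) => u Du uM.
have := HBg u uM; have := HBC u Du uM; have := HBp u Du uM => pB CB gB.
have e2 : 0 <= (e ^+ 2)^-1 by rewrite invr_ge0 exprn_ge0// ltW.
have e1 : 0 <= e^-1 by rewrite invr_ge0 ltW.
have e4 : 0 <= 4 / e by rewrite divr_ge0// ltW.
rewrite /K (ger0_norm (g0 u)); apply: lerD.
  by apply: lerD; exact: ler_wpM2r.
apply: lerD => //; apply: ler_pM.
- by rewrite addr_ge0// mulr_ge0// C0.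
- by rewrite mulr_ge0.
- by apply: lerD => //; exact: ler_wpM2l.
- exact: ler_wpM2l.
Qed.

Let h u := saddle_series e (a u).

Let bump u (x y : R) : R :=
  g u + p u * ((x - u) + (y - u)) / 2 + h u (x - u) (y - u)
  - K u * ((x - u) * (y - u)).

Let h_le u x y : D u -> `|h u x y| <= 2 / e * (`|x| + `|y|) * C u.
Proof.
by move=> Du; apply: saddle_series_le => // [k|n]; [exact: a0|exact: aC].
Qed.

Let bump_separately_convex u : D u -> separately_convex (bump u).
Proof.
move=> Du.
have -> : bump u = fun x y => h u (1 * x + - u) (1 * y + - u) +
    ((g u - p u * u - K u * u ^+ 2) + (p u / 2 + K u * u) * x
     + (p u / 2 + K u * u) * y + (- K u) * (x * y)).
  by apply/funext => x; apply/funext => y; rewrite /bump !mul1r; field.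
apply: separately_convexD; last exact: separately_convex_bilinear.
apply: (@separately_convex_affine _ _ _ (h u)).
apply: (@saddle_series_separately_convex _ _ (C u)) => // [k|n].
- exact: a0.
- exact: aC.
Qed.

Let bump_diagE u t :
  bump u (u + t) (u + t) = g u + p u * t + h u t t - K u * t ^+ 2.
Proof. by rewrite /bump (addrC u) addrK; field. Qed.

(** Within distance [e] the series drops by at least [a u k] at the matching dyadic scale, and [gp]
    applies. Farther away the quadratic term makes the bump nonpositive. *)
Let bump_diag_le u v : D u -> bump u v v <= g v.
Proof.
move=> Du; have -> : v = u + (v - u) by ring.
move: (v - u) => {v} t; rewrite bump_diagE.
have h0 : h u t t <= 0.
  by apply: (@saddle_series_diag_le0 _ _ (C u)) => // [k|n]; [exact: a0|exact: aC].
have [te|te] := leP `|t| e.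
  have [->|tn0] := eqVneq t 0.
    rewrite addr0; have := h_le u 0 0 Du.
    by rewrite normr0 addr0 mulr0 mul0r normr_le0 => /eqP ->; lra.
  (* The least [k] satisfying the first inequality works: minimality yields the second one, and for
     [k = 0] it is [te]. *)
  have [k [kt tk]] : exists k, e / 2 ^+ k.+1 <= `|t| /\ `|t| <= e / 2 ^+ k.
    have ex : exists n, e / 2 ^+ n.+1 <= `|t|.
      have t0 : 0 < `|t| by rewrite normr_gt0.
      have [N HN] : exists N, e / `|t| < N%:R.
        by exists (Num.bound (e / `|t|)); rewrite archi_boundP// divr_ge0// ltW.
      exists N; rewrite ler_pdivrMr ?exprn_gt0// mulrC -ler_pdivrMr//.
      apply: le_trans (ltW HN) _; rewrite -natrX ler_nat.
      by rewrite ltnW// (leq_trans (ltn_expl N (leqnn 2)))// leq_exp2l.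
    case: (ex_minnP ex) => -[|m] mt mmin.
      by exists 0%N; rewrite expr0 divr1.
    exists m.+1; split => //; rewrite leNgt; apply/negP => /ltW /mmin.
    by rewrite ltnn.
  have hk : h u t t <= - a u k.
    apply: (@saddle_series_diag_le _ _ (C u)) => // [j|n]; [exact: a0|exact: aC].
  have := gp u k t Du tk; have := mulr_ge0 (K0 u Du) (sqr_ge0 t).
  by lra.
apply: le_trans (g0 _).
have tt : t ^+ 2 = `|t| ^+ 2 by rewrite real_normK ?num_real.
have s1 : g u <= `|g u| / e ^+ 2 * t ^+ 2.
  rewrite (ger0_norm (g0 u)) -mulrA ler_peMr// mulrC ler_pdivlMr ?exprn_gt0//.
  by rewrite mul1r tt !expr2; apply: ler_pM; apply: ltW.
have s2 : p u * t <= `|p u| / e * t ^+ 2.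
  apply: le_trans (ler_norm _) _; rewrite normrM -mulrA ler_wpM2l// mulrC.
  by rewrite ler_pdivlMr// tt expr2 ler_wpM2l// ltW.
have s3 : 0 <= (`|g u| + (`|p u| + 4 / e * C u) * (2 * `|u|)) * t ^+ 2.
  apply: mulr_ge0; last exact: sqr_ge0.
  by have := C0 u Du => ?; rewrite !(addr_ge0, mulr_ge0, invr_ge0)// ltW.
by rewrite /K 2!mulrDl; lra.
Qed.

Let bump_le u x y (N : R) : D u -> `|x - u| <= N -> `|y - u| <= N ->
  bump u x y <= g u + (`|p u| + 4 / e * C u) * N - K u * ((x - u) * (y - u)).
Proof.
move=> Du xN yN; rewrite /bump lerD2r -addrA lerD2l mulrDl; apply: lerD.
  rewrite -mulrA; apply: le_trans (ler_norm _) _; rewrite normrM ler_wpM2l//.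
  have := ler_normD (x - u) (y - u).
  by rewrite normrM (gtr0_norm (_ : 0 < 2^-1 :> R)) ?invr_gt0//; lra.
apply: le_trans (ler_norm _) (le_trans (h_le u _ _ Du) _).
have e4 : 0 <= 2 / e by rewrite divr_ge0// ltW.
rewrite [leRHS](_ : _ = 2 / e * (N + N) * C u); last first.
  by field; rewrite gt_eqF.
by rewrite ler_wpM2r ?C0// ler_wpM2l// lerD.
Qed.

(** Base points with [u] at most [M + 1] in absolute value are handled by the local bounds. For the
    others [x - u] and [y - u] have the same sign and size at least 1, so [K u] times their product
    absorbs everything else and the bump is at most 0. *)
Let bump_ubound x y : has_ubound [set bump u x y | u in D].
Proof.
pose M := `|x| + `|y|.
have M0 : 0 <= M by rewrite addr_ge0.
have [xM yM] : `|x| <= M /\ `|y| <= M by rewrite /M lerDl lerDr.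
have [Bg HBg] := g_bnd (M + 1); have [BC HBC] := C_bnd (M + 1).
have [Bp HBp] := p_bnd (M + 1); have [BK HBK] := K_bnd (M + 1).
pose N := M + (M + 1); have N0 : 0 <= N by rewrite /N; lra.
exists (Num.max 0 (Bg + (Bp + 4 / e * BC) * N + BK * N ^+ 2)) => _ [u Du <-].
rewrite le_max; have [uM|uM] := leP `|u| (M + 1); apply/orP; [right|left].
  have xN : `|x - u| <= N by apply: le_trans (ler_normB _ _) _; rewrite lerD.
  have yN : `|y - u| <= N by apply: le_trans (ler_normB _ _) _; rewrite lerD.
  apply: le_trans (bump_le u x y N Du xN yN) _.
  have e4 : 0 <= 4 / e by rewrite divr_ge0// ltW.
  apply: lerD; first apply: lerD; first exact: HBg.
    apply: ler_wpM2r => //; apply: lerD; first exact: HBp.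
    by rewrite ler_wpM2l// HBC.
  rewrite -mulrN; apply: le_trans (ler_norm _) _.
  rewrite normrM normrN normrM (ger0_norm (K0 u Du)).
  apply: ler_pM => //; [exact: K0|exact: HBK|by rewrite expr2 ler_pM].
have xu : `|x - u| <= 2 * `|u| by apply: le_trans (ler_normB _ _) _; lra.
have yu : `|y - u| <= 2 * `|u| by apply: le_trans (ler_normB _ _) _; lra.
apply: le_trans (bump_le u x y _ Du xu yu) _.
have xy1 : 1 <= (x - u) * (y - u).
  move: xM yM; rewrite !ler_norml => /andP[? ?] /andP[? ?].
  by move: uM; rewrite lter_normr => /orP[?|?]; nra.
have := ler_wpM2l (K0 u Du) xy1; rewrite mulr1.
have := C0 u Du => ? ?.
have s1 : 0 <= `|g u| / e ^+ 2 + `|p u| / e.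
  by rewrite !(addr_ge0, mulr_ge0, invr_ge0, exprn_ge0)// ltW.
have s2 : `|g u| + (`|p u| + 4 / e * C u) * (2 * `|u|) <= K u.
  by rewrite /K lerDr.
by have := ler_norm (g u); lra.
Qed.

Let bump_approx (v d : R) : 0 < d -> exists2 u, D u & g v - d <= bump u v v.
Proof.
move=> d0; have d2 : 0 < d / 2 by rewrite divr_gt0.
have [r r0 Hr] := g_lsc v _ d2.
have [BC HBC] := C_bnd (`|v| + 1).
have [Bp HBp] := p_bnd (`|v| + 1); have [BK HBK] := K_bnd (`|v| + 1).
(* For [t = v - u] of size at most 1, the slope, series and quadratic terms lower the bump by at
   most [L] times the size of [t]. The radius [s] makes this loss at most [d / 2]; the other half of
   [d] pays for passing from [g v] to [g u]. *)
pose L := `|Bp| + 4 / e * `|BC| + `|BK| + 1.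
have L0 : 0 < L.
  by rewrite /L ltr_pwDr// !(addr_ge0, mulr_ge0, invr_ge0)// ltW.
pose s := Num.min (Num.min r 1) (d / 2 / L).
have s0 : 0 < s by rewrite !lt_min r0 ltr01 divr_gt0.
have [u [uv Du]] : (ball v s `&` D) !=set0.
  by apply: densD; [exists v; exact: ballxx|exact: ball_open].
exists u => //; rewrite /ball /= distrC !lt_min in uv.
move: uv => /andP[/andP[ur u1] uL].
have uM : `|u| <= `|v| + 1.
  have -> : u = v + (u - v) by ring.
  by apply: le_trans (ler_normD _ _) _; rewrite lerD2l ltW.
have vE : u + (v - u) = v by ring.
have := bump_diagE u (v - u); rewrite vE => -> {vE}.
rewrite distrC in u1 uL; move: (v - u) u1 uL => t t1 tL.
have hL : - (4 / e * `|BC| * `|t|) <= h u t t.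
  have := h_le u t t Du; rewrite ler_norml => /andP[+ _].
  apply: le_trans; rewrite lerN2.
  rewrite [leRHS](_ : _ = 2 / e * (`|t| + `|t|) * `|BC|); last first.
    by field; rewrite gt_eqF.
  rewrite ler_wpM2l//; last exact: le_trans (HBC u Du uM) (ler_norm _).
  by rewrite mulr_ge0 ?divr_ge0 ?addr_ge0// ltW.
have pL : - (`|Bp| * `|t|) <= p u * t.
  suff : `|p u * t| <= `|Bp| * `|t| by rewrite ler_norml => /andP[].
  by rewrite normrM ler_wpM2r// (le_trans (HBp u Du uM))// ler_norm.
have KL : K u * t ^+ 2 <= `|BK| * `|t|.
  rewrite -(real_normK (num_real t)) expr2 mulrA ler_wpM2r//.
  apply: le_trans (le_trans (HBK u Du uM) (ler_norm _)).
  by rewrite ler_piMr ?K0// ltW.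
have tL' : L * `|t| <= d / 2 by rewrite mulrC -ler_pdivlMr// ltW.
have := Hr u ur; have := normr_ge0 t; move: tL'; rewrite /L.
by lra.
Qed.

Lemma trace_of_nonneg :
  exists f : R -> R -> R, separately_convex f /\ forall u, f u u = g u.
Proof.
have D0 : D !=set0.
  have [u [_ Du]] : ([set: R] `&` D) !=set0 by apply: densD; [exists 0|exact: openT].
  by exists u.
exists (fun x y => sup [set bump u x y | u in D]); split.
  exact: separately_convex_sup.
move=> v; apply/le_anti/andP; split.
  apply: ge_sup => [|_ [u Du <-]]; last exact: bump_diag_le.
  by case: D0 => u Du; exists (bump u v v), u.
apply/ler_addgt0Pr => d d0; rewrite -lerBlDr.
have [u Du] := bump_approx v d d0; move/le_trans; apply.
by apply: ub_le_sup => //; exists u.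
Qed.

End TraceOfNonneg.

(** * A separately convex potential with concave and arbitrarily low trace *)

Section ConvexMajorant.
Context {R : realType}.
Variable m : nat -> R.
Hypothesis m0 : forall n, 0 <= m n.

Lemma convex_pos_part (c d : R) : convex_fun (fun x => Num.max (c * x + d) 0).
Proof.
move=> a b t t0 t1.
have ra : Num.max (c * a + d) 0 >= c * a + d by rewrite le_max lexx.
have rb : Num.max (c * b + d) 0 >= c * b + d by rewrite le_max lexx.
have ra0 : Num.max (c * a + d) 0 >= 0 by rewrite le_max lexx orbT.
have rb0 : Num.max (c * b + d) 0 >= 0 by rewrite le_max lexx orbT.
by rewrite ge_max; apply/andP; split; nra.
Qed.

(* Its trace is [- (t - k)_+ ^ 2], and it vanishes on the quadrant [x, y <= k]. *)
Let corner (k x y : R) : R :=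
  (- k ^+ 2 + k * x + k * y + (-1) * (x * y)) +
  Num.max (-1 * x + k) 0 * Num.max (-1 * y + k) 0.

(** The second corner is the first one reflected through the origin, so the well vanishes on the
    square of half side [k]. The weight is [m k.+1] because the squared distance reaches 1 only
    beyond [k.+1]. *)
Let well (k : nat) (x y : R) : R :=
  m k.+1 * (corner k%:R x y + corner k%:R (-1 * x + 0) (-1 * y + 0)).

Let corner_separately_convex k : separately_convex (corner k).
Proof.
apply: separately_convexD; first exact: separately_convex_bilinear.
by apply: separately_convexM => [x|x||]; rewrite ?le_max ?lexx ?orbT//;
  exact: convex_pos_part.
Qed.

Let well_separately_convex k : separately_convex (well k).
Proof.
apply: separately_convexZ => //; apply: separately_convexD.
  exact: corner_separately_convex.
apply: (@separately_convex_affine _ _ _ (corner k%:R)).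
exact: corner_separately_convex.
Qed.

Let well0 (k : nat) x y : `|x| <= k%:R -> `|y| <= k%:R -> well k x y = 0.
Proof.
rewrite !ler_norml => /andP[? ?] /andP[? ?].
by rewrite /well /corner !max_l; [ring|lra..].
Qed.

(** An infinite sum of wells that is locally finite: those with index beyond the cut-off vanish at
    [(x, y)]. By [potentialE] any cut-off dominating both coordinates gives the same value, so
    finitely many points can share one. *)
Definition potential (x y : R) : R :=
  - m 0 + \sum_(k < Num.bound (`|x| + `|y|)) well k x y.

Let big_ord_stable (F : nat -> R) (N n : nat) : (N <= n)%N ->
  (forall k, (N <= k)%N -> F k = 0) -> \sum_(k < n) F k = \sum_(k < N) F k.
Proof.
move=> Nn F0; rewrite -!(big_mkord xpredT) (big_cat_nat _ (n := N))//=.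
rewrite [X in _ + X]big_nat_cond [X in _ + X]big1 ?addr0// => k /andP[/andP[Nk _] _].
exact: F0.
Qed.

Let potentialE (N : nat) x y : `|x| <= N%:R -> `|y| <= N%:R ->
  potential x y = - m 0 + \sum_(k < N) well k x y.
Proof.
move=> xN yN; rewrite /potential; congr (_ + _).
set M := Num.bound _.
have xyM : `|x| + `|y| <= M%:R by rewrite ltW// archi_boundP// addr_ge0.
have xM : `|x| <= M%:R by apply: le_trans xyM; rewrite lerDl.
have yM : `|y| <= M%:R by apply: le_trans xyM; rewrite lerDr.
have well_out n k : `|x| <= n%:R -> `|y| <= n%:R -> (n <= k)%N -> well k x y = 0.
  by rewrite -(ler_nat R) => xn yn nk; apply: well0; exact: le_trans nk.
have [MN|/ltnW NM] := leqP M N.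
  by symmetry; apply: (big_ord_stable (fun k => well k x y)) => // k; exact: well_out.
by apply: (big_ord_stable (fun k => well k x y)) => // k; exact: well_out.
Qed.

Lemma potential_separately_convex : separately_convex potential.
Proof.
split=> z a b t t0 t1.
- set c := t * a + _; pose N := Num.bound (`|z| + `|a| + `|b| + `|c|).
  have : `|z| + `|a| + `|b| + `|c| < N%:R by rewrite archi_boundP// !addr_ge0.
  have := normr_ge0 z; have := normr_ge0 a; have := normr_ge0 b.
  have := normr_ge0 c => ? ? ? ? ?.
  rewrite !(potentialE N); try lra.
  have [+ _] := @separately_convex_sum _ N well well_separately_convex.
  by move=> /(_ z a b t t0 t1); rewrite -/c; lra.
- set c := t * a + _; pose N := Num.bound (`|z| + `|a| + `|b| + `|c|).
  have : `|z| + `|a| + `|b| + `|c| < N%:R by rewrite archi_boundP// !addr_ge0.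
  have := normr_ge0 z; have := normr_ge0 a; have := normr_ge0 b.
  have := normr_ge0 c => ? ? ? ? ?.
  rewrite !(potentialE N); try lra.
  have [_] := @separately_convex_sum _ N well well_separately_convex.
  by move=> /(_ z a b t t0 t1); rewrite -/c; lra.
Qed.

Let corner_diag k t : corner k t t = - Num.max (t - k) 0 ^+ 2.
Proof.
rewrite /corner; have [tk|tk] := leP t k.
  by rewrite max_l ?max_r; [ring|lra..].
by rewrite max_r ?max_l; [ring|lra..].
Qed.

Let well_diag k t : well k t t =
  - (m k.+1 * (Num.max (t - k%:R) 0 ^+ 2 + Num.max (- t - k%:R) 0 ^+ 2)).
Proof.
rewrite /well !corner_diag (_ : -1 * t + 0 - k%:R = - t - k%:R); ring.
Qed.

Lemma potential_diag_bounded (M : R) : exists B : R,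
  forall t, `|t| <= M -> - potential t t <= B.
Proof.
pose N := Num.bound `|M|.
exists (m 0 + \sum_(k < N) m k.+1 * (M ^+ 2 + M ^+ 2)) => t tM.
have tN : `|t| <= N%:R.
  by apply: le_trans tM (le_trans (ler_norm _) (ltW _)); rewrite archi_boundP.
rewrite (potentialE N)// opprD opprK lerD2l -sumrN; apply: ler_sum => k _.
rewrite well_diag opprK ler_wpM2l//.
have k0 : 0 <= k%:R :> R by [].
move: tM; rewrite ler_norml => /andP[? ?].
have [?|?] := leP (t - k%:R) 0; have [?|?] := leP (- t - k%:R) 0; nra.
Qed.

(** Take the least such [n]. If it is [n'.+1], then [t] exceeds [n'.+1] in absolute value, and well
    [n'] alone already contributes [- m n'.+1]; if it is 0, the constant [- m 0] suffices. *)
Lemma potential_diag_le t : exists2 n, `|t| <= n.+1%:R & potential t t <= - m n.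
Proof.
have sum_le N : \sum_(k < N) well k t t <= 0.
  apply: sumr_le0 => k _; rewrite well_diag oppr_le0.
  by rewrite mulr_ge0// addr_ge0// sqr_ge0.
have ex : exists n, `|t| <= n.+1%:R.
  exists (Num.bound `|t|); apply: ltW.
  by apply: lt_trans (archi_boundP _) _; rewrite // ltr_nat.
case: (ex_minnP ex) => -[|n] tn nmin.
  by exists 0%N => //; rewrite /potential gerDl.
exists n.+1 => //.
have nt : n.+1%:R < `|t|.
  by rewrite ltNge; apply/negP => /nmin; rewrite ltnn.
rewrite (potentialE n.+2)// (bigD1 (Ordinal (leqnSn n.+1 : (n < n.+2)%N)))//=.
have : \sum_(k < n.+2 | k != Ordinal (leqnSn n.+1 : (n < n.+2)%N)) well k t t <= 0.
  apply: sumr_le0 => k _; rewrite well_diag oppr_le0.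
  by rewrite mulr_ge0// addr_ge0// sqr_ge0.
move=> rest; have := m0 0.
suff : well n t t <= - m n.+1 by lra.
rewrite well_diag lerN2 ler_peMr//.
move: nt; rewrite -natr1 lter_normr => /orP[?|?].
  by have [?|?] := leP (t - n%:R) 0; have [?|?] := leP (- t - n%:R) 0; nra.
by have [?|?] := leP (t - n%:R) 0; have [?|?] := leP (- t - n%:R) 0; nra.
Qed.

(** Up to a constant, the negated trace is a locally finite sum of squared positive parts with
    nonnegative weights. The slope [q] is its derivative at [u], and [sq] says that a squared
    positive part lies above its tangents. *)
Lemma potential_diag_subgradient u : exists q : R,
  forall t, - potential u u + q * t <= - potential (u + t) (u + t).
Proof.
pose q k := m k.+1 *
  (2 * Num.max (u - k%:R) 0 - 2 * Num.max (- u - k%:R) 0).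
pose M := Num.bound `|u|.
have uM : `|u| <= M%:R by rewrite ltW// archi_boundP.
exists (\sum_(k < M) q k) => t.
pose N := maxn M (Num.bound `|u + t|).
have uN : `|u| <= N%:R by apply: le_trans uM _; rewrite ler_nat leq_maxl.
have utN : `|u + t| <= N%:R.
  have : `|u + t| <= (Num.bound `|u + t|)%:R by rewrite ltW// archi_boundP.
  by move=> /le_trans; apply; rewrite ler_nat leq_maxr.
rewrite -(big_ord_stable q M N) ?leq_maxl//; last first.
  move=> k; rewrite -(ler_nat R) => /(le_trans uM); rewrite ler_norml.
  by move=> /andP[? ?]; rewrite /q !max_r; [ring|lra..].
rewrite !(potentialE N)// !opprD !opprK -!sumrN mulr_suml -addrA -big_split /=.
rewrite lerD2l; apply: ler_sum => k _; rewrite !well_diag !opprK /q -mulrA -mulrDr.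
apply: ler_wpM2l => //.
have sq (x s : R) : Num.max x 0 ^+ 2 + 2 * Num.max x 0 * s <= Num.max (x + s) 0 ^+ 2.
  by have [?|?] := leP x 0; have [?|?] := leP (x + s) 0; nra.
have := sq (u - k%:R) t; have := sq (- u - k%:R) (- t).
have -> : - u - k%:R - t = - (u + t) - k%:R by ring.
have -> : u - k%:R + t = u + t - k%:R by ring.
by lra.
Qed.

End ConvexMajorant.

(** * Reduction of continuous functions to nonnegative ones *)

Section TraceOfDyadic.
Context {R : realType}.

Lemma locally_lipschitz_continuous (g : R -> R) :
  locally_lipschitz g -> continuous g.
Proof.
move=> gL x; have [r [L [r0 gxL]]] := gL x.
apply/cvgrPdist_lt => d d0; near=> y.
have yr : `|y - x| < r.
  rewrite distrC; near: y; exact: (@cvgr_dist_lt _ _ _ _ _ id x cvg_id).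
have yL : `|x - y| < d / (`|L| + 1).
  near: y; apply: (@cvgr_dist_lt _ _ _ _ _ id x cvg_id).
  by rewrite divr_gt0// ltr_pwDr.
apply: le_lt_trans (gxL x y _ yr) _; first by rewrite subrr normr0.
have L1 : 0 < `|L| + 1 by rewrite ltr_pwDr.
move: yL; rewrite ltr_pdivlMr// => yL.
by have := normr_ge0 (x - y); have := ler_norm L; nra.
Unshelve. all: by end_near.
Qed.

Lemma continuous_bounded (g : R -> R) : continuous g -> forall M : R,
  exists B : R, forall u, `|u| <= M -> `|g u| <= B.
Proof.
move=> cg M; have [M0|M0] := ltP M 0.
  by exists 0 => u /le_lt_trans /(_ M0); rewrite normr_lt0.
have MM : - M <= M by lra.
have cn : {within `[- M, M], continuous (fun x => `|g x|)}.
  by apply: continuous_subspaceT => x; apply: cvg_norm; exact: cg.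
have [c _ cmax] := EVT_max MM cn.
by exists `|g c| => u; rewrite ler_norml => uM; apply: cmax; rewrite in_itv.
Qed.

Lemma trace_of_dyadic (g p C : R -> R) (a : R -> nat -> R) (D : set R) (e : R) :
  0 < e -> dense D -> continuous g ->
  (forall u k, D u -> 0 <= a u k) ->
  (forall u n, D u -> \sum_(k < n) a u k * 2 ^+ k <= C u) ->
  (forall u k (t : R), D u -> `|t| <= e / 2 ^+ k ->
    g u + p u * t - a u k <= g (u + t)) ->
  (forall M : R, exists B : R, forall u, D u -> `|u| <= M -> C u <= B) ->
  exists f : R -> R -> R, separately_convex f /\ forall u, f u u = g u.
Proof.
move=> e0 densD cg a0 aC gp C_bnd.
have gB := continuous_bounded g cg.
have [m mB] := choice (fun n : nat => gB n.+1%:R).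
have m0 n : 0 <= m n by apply: le_trans (mB n 0 _); rewrite ?normr0.
have [q qP] := choice (potential_diag_subgradient m m0).
pose G t := - potential m t t.
have [f [fcvx fG]] : exists f : R -> R -> R,
    separately_convex f /\ forall u, f u u = g u + G u.
  (* Since [q u] is a subgradient of [G] at [u], adding it to the slope preserves the dyadic lower
     bounds with the same [a] and [C]. *)
  apply: (@trace_of_nonneg _ _ (fun u => p u + q u) C a D e) => //.
  - move=> x; have [n xn] := potential_diag_le m m0 x.
    by have := mB n x xn; rewrite ler_norml /G => /andP[? _]; lra.
  - move=> u k t Du tk; have := gp u k t Du tk; have := qP u t.
    by rewrite /G; lra.
  - move=> M; have [B HB] := gB M; have [B' HB'] := potential_diag_bounded m m0 M.
    exists (B + B') => u uM; rewrite /G lerD ?HB'//.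
    exact: le_trans (ler_norm _) (HB u uM).
  move=> v d d0; have d2 : 0 < d / 2 by rewrite divr_gt0.
  have /nbhs_ballP[r /= r0 Hr] : \forall u \near v, `|g v - g u| < d / 2.
    exact: cvgr_dist_lt (cg v) _ d2.
  (* Within this radius the supporting line of [G] at [v] drops by at most [d / 2], which gives
     lower semicontinuity of [G]. *)
  pose s := d / 2 / (`|q v| + 1).
  have q1 : 0 < `|q v| + 1 by rewrite ltr_pwDr.
  exists (Num.min r s); first by rewrite lt_min r0 !divr_gt0.
  move=> u; rewrite lt_min => /andP[ur us].
  have : `|g v - g u| < d / 2 by apply: Hr; rewrite /ball /= distrC.
  rewrite ltr_norml => /andP[_ guv].
  have := qP v (u - v); rewrite -/(G v) (_ : v + (u - v) = u); last by ring.
  rewrite -/(G u) => Guv.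
  move: us; rewrite /s ltr_pdivlMr// => us.
  have : - (`|q v| * `|u - v|) <= q v * (u - v).
    by rewrite -normrM; have := ler_norm (- (q v * (u - v))); rewrite normrN; lra.
  by have := normr_ge0 (u - v); lra.
exists (fun x y => f x y + potential m x y); split.
  by apply: separately_convexD => //; exact: potential_separately_convex.
by move=> u; rewrite fG /G; lra.
Qed.

End TraceOfDyadic.

(** * From the integral condition to dyadic sums *)

Section PhiIntegral.
Context {R : realType}.

(** On the interval from [eps / 2 ^+ k.+1] to [eps / 2 ^+ k], bound [psi] below by its value at the
    left end and [1 / x ^+ 2] by its value at the right end; multiplying by the length gives the
    [k]-th summand. *)
Lemma dyadic_sum_le_integral (psi : R -> R) (eps : R) (n : nat) : 0 < eps ->
  nondecreasing_fun psi -> (forall x, 0 <= psi x) ->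
  ((\sum_(k < n) psi (eps / 2 / 2 ^+ k) * 2 ^+ k / (2 * eps))%:E <=
   \int[lebesgue_measure]_(x in `]0%R, eps]%classic) (psi x / x ^+ 2)%:E)%E.
Proof.
move=> eps0 psi_nd psi0.
pose F (x : R) : \bar R := (psi x / x ^+ 2)%:E.
have mF : measurable_fun (`]0, eps]%classic : set R) F.
  apply/measurable_EFinP; apply: measurable_funM.
    exact: nondecreasing_measurable.
  apply: subspace_continuous_measurable_fun => //.
  apply: continuous_in_subspaceT => x; rewrite inE /= in_itv/= => /andP[x0 _].
  apply: cvgV; first by rewrite gt_eqF// exprn_gt0.
  exact: exprn_continuous.
have mpsi (A : set R) : measurable A -> A `<=` `]0, eps] -> measurable_fun A F.
  by move=> mA A0; apply: measurable_funS mF.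
have psi_ge0 x : (0 <= (psi x / x ^+ 2)%:E)%E.
  by rewrite lee_fin divr_ge0// sqr_ge0.
have eps2 k : 0 < eps / 2 ^+ k by rewrite divr_gt0// exprn_gt0.
have eps2S k : eps / 2 ^+ k.+1 <= eps / 2 ^+ k.
  by rewrite ler_pM2l// lef_pV2 ?posrE ?exprn_gt0// ler_eXn2l ?ltr1n.
have eps2_le k : eps / 2 ^+ k <= eps.
  by elim: k => [|k]; [rewrite divr1|exact: le_trans (eps2S k)].
pose J k : set R := `]eps / 2 ^+ k, eps]%classic.
have mJ k : measurable (J k) by exact: measurable_itv.
have J0 k : J k `<=` `]0, eps] by apply: subset_itvr; rewrite bnd_simp ltW.
apply: (@le_trans _ _ (\int[lebesgue_measure]_(x in J n)
    (psi x / x ^+ 2)%:E)%E); last first.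
  by apply: ge0_subset_integral => //; exact: mJ.
elim: n => [|n IHn]; first by rewrite big_ord0 integral_ge0.
pose I : set R := `]eps / 2 ^+ n.+1, eps / 2 ^+ n]%classic.
have mI : measurable I by exact: measurable_itv.
have I0 : I `<=` `]0, eps].
  by apply: subset_itv; rewrite bnd_simp// ltW.
have -> : J n.+1 = I `|` J n.
  by rewrite -itv_bndbnd_setU// bnd_simp.
rewrite ge0_integral_setU//; last 3 first.
- exact: mJ.
- by apply: mpsi; [exact: measurableU|move=> x; case=> [/I0|/J0]].
- apply/disj_setPS => x []; rewrite /I /J /= !in_itv/= => /andP[_ xn] /andP[nx _].
  by move: (lt_le_trans nx xn); rewrite ltxx.
rewrite big_ord_recr /= EFinD addeC leeD//.
pose w := psi (eps / 2 / 2 ^+ n) / (eps / 2 ^+ n) ^+ 2.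
apply: (@le_trans _ _ (\int[lebesgue_measure]_(x in I) (cst w%:E) x)%E).
  rewrite integral_cst//= /I lebesgue_measure_itv/= lte_fin.
  have lt2 : eps / 2 ^+ n.+1 < eps / 2 ^+ n.
    by rewrite ltr_pM2l// ltf_pV2 ?posrE ?exprn_gt0// ltr_eXn2l ?ltr1n.
  rewrite lt2 -EFinB -EFinM lee_fin /w [2 ^+ n.+1]exprS le_eqVlt; apply/orP; left.
  by apply/eqP; field; rewrite expf_neq0// gt_eqF.
apply: ge0_le_integral => //.
- by move=> x _; rewrite lee_fin divr_ge0// sqr_ge0.
- by apply: mpsi.
move=> x; rewrite /I /= in_itv/= => /andP[nx xn].
have x0 : 0 < x := lt_trans (eps2 _) nx.
rewrite lee_fin /w ler_pM ?psi0// ?invr_ge0 ?sqr_ge0//.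
  by apply: psi_nd; rewrite -mulrA -invfM -exprS ltW.
by rewrite lef_pV2 ?posrE ?exprn_gt0// !expr2 ler_pM// ltW.
Qed.

Variables (g : R -> R) (u : R).
Hypothesis g_bnd : forall M : R, exists B : R, forall v, `|v| <= M -> `|g v| <= B.

Lemma phi_le (t x : R) : `|t| <= x ->
  phi g u x <= g (u + t) - g u - derive1 g u * t.
Proof.
move=> tx; apply: ge_inf; last by exists t.
have [B HB] := g_bnd (`|u| + x).
exists (- B - g u - `|derive1 g u| * x) => _ [s sx <-].
have : `|g (u + s)| <= B.
  by apply: HB; apply: le_trans (ler_normD _ _) _; rewrite lerD2l.
rewrite ler_norml => /andP[? _].
have : derive1 g u * s <= `|derive1 g u| * x.
  by apply: le_trans (ler_norm _) _; rewrite normrM ler_wpM2l.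
by lra.
Qed.

Lemma phi_le0 (x : R) : phi g u x <= 0.
Proof.
have [x0|x0] := leP 0 x.
  have := @phi_le 0 x; rewrite normr0 addr0 subrr mulr0 subr0; exact.
(* For negative [x] the infimum is over the empty set and equals 0 by convention; this keeps [phi]
   monotone on the whole line. *)
rewrite /phi (_ : [set t | _] = set0) ?image_set0 ?inf0//.
by apply/seteqP; split=> // t /= /le_lt_trans /(_ x0); rewrite normr_lt0.
Qed.

Lemma phi_nonincreasing : nonincreasing_fun (phi g u).
Proof.
move=> x y xy; have [x0|x0] := leP 0 x; last first.
  rewrite [leRHS](_ : _ = 0) ?phi_le0//.
  rewrite /phi (_ : [set t | _] = set0) ?image_set0 ?inf0//.
  by apply/seteqP; split=> // t /= /le_lt_trans /(_ x0); rewrite normr_lt0.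
apply: lb_le_inf.
  by exists (g (u + 0) - g u - derive1 g u * 0), 0 => //=; rewrite normr0.
by move=> _ [t /= tx <-]; apply: phi_le; exact: le_trans xy.
Qed.

Lemma phi_integralE (eps : R) : phi_integral g eps u =
  (- \int[lebesgue_measure]_(x in `]0%R, eps]%classic)
      ((- phi g u x) / x ^+ 2)%:E)%E.
Proof.
rewrite /phi_integral /= -integralN.
  by apply: eq_integral => x _; rewrite -EFinN mulNr opprK.
(* Pulling the sign out requires that the integrals of the positive and negative parts are not both
   infinite; here the negative part vanishes. *)
rewrite [X in (_ +? - X)%E](_ : _ = 0%E) ?oppe0; last first.
  apply: integral0_eq => x _; rewrite funenegE; apply/max_idPr.
  rewrite -EFinN lee_fin mulNr opprK.
  by rewrite mulr_le0_ge0 ?phi_le0// invr_ge0 sqr_ge0.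
by rewrite fin_num_adde_defl.
Qed.

Lemma phi_dyadic_sum_le (eps C : R) (n : nat) : 0 < eps ->
  (`|phi_integral g eps u| <= C%:E)%E ->
  \sum_(k < n) - phi g u (eps / 2 / 2 ^+ k) * 2 ^+ k <= 2 * eps * C.
Proof.
move=> eps0; rewrite phi_integralE abseN => intC.
have psi_nd : nondecreasing_fun (fun x => - phi g u x).
  by move=> x y xy /=; rewrite lerN2; exact: phi_nonincreasing.
have psi0 x : 0 <= - phi g u x by rewrite oppr_ge0 phi_le0.
have := le_trans (dyadic_sum_le_integral _ eps n eps0 psi_nd psi0)
  (le_trans (lee_abs _) intC).
by rewrite lee_fin -mulr_suml ler_pdivrMr ?mulr_gt0// [C * _]mulrC.
Qed.

End PhiIntegral.

(** * Instantiation of the dyadic criterion with the values of [phi] *)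

Theorem theorem7p2 (R : realType) (g : R -> R) :
  locally_lipschitz g ->
  (exists eps : R, exists D : set R,
     0 < eps /\ dense D /\
     (forall u, D u -> derivable g u 1) /\
     (forall B : set R, (exists M : R, forall x, B x -> `|x| <= M) ->
        exists C : R, forall u, D u -> B u ->
          (`|phi_integral g eps u| <= C%:E)%E)) ->
  exists f : R -> R -> R, separately_convex f /\ (forall u : R, f u u = g u).
Proof.
move=> /locally_lipschitz_continuous cg [eps [D [eps0 [densD [_ intC]]]]].
have gB := continuous_bounded g cg.
have C_bnd (M : R) : exists B : R, forall u, D u -> `|u| <= M ->
    (`|phi_integral g eps u| <= B%:E)%E.
  by apply: (intC [set u | `|u| <= M]); exists M.
pose C u := fine `|phi_integral g eps u|%E.
have CE u : D u -> (`|phi_integral g eps u| = (C u)%:E)%E.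
  (* The bound for radius [|u|] covers [u] itself, so the integral is finite and [fine] loses
     nothing. *)
  move=> Du; have [B /(_ u Du (lexx _)) HB] := C_bnd `|u|.
  rewrite /C fineK// ge0_fin_numE//; exact: le_lt_trans HB (ltry _).
(* The comparison with the integral samples [phi] at left end points [eps / 2 ^+ k.+1], hence the
   scale [eps / 2], and it costs the factor [2 * eps]. *)
apply: (@trace_of_dyadic _ g (derive1 g) (fun u => 2 * eps * C u)
  (fun u k => - phi g u (eps / 2 / 2 ^+ k)) D (eps / 2)) => //.
- by rewrite divr_gt0.
- by move=> u k _; rewrite oppr_ge0 phi_le0.
- by move=> u n Du; apply: phi_dyadic_sum_le => //; rewrite CE.
- by move=> u k t _ tk; have := phi_le g u gB t _ tk; lra.
- move=> M; have [B HB] := C_bnd M; exists (2 * eps * B) => u Du uM.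
  apply: ler_wpM2l; first by rewrite mulr_ge0// ltW.
  by have := HB u Du uM; rewrite CE// lee_fin.
Qed.
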